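(* Let $r\ge1$, let $\vec n=(n_1,\dots,n_r)$ be nonnegative integers with $|\vec n|=n_1+\cdots+n_r\geq 1$, and let $\alpha_0,\alpha_1,\dots,\alpha_r>-1$ be real numbers with $\alpha_i-\alpha_j\notin\mathbb Z$ whenever $i\ne j$. Let $H^{\vec\alpha,\alpha_0,N}_{\vec n}$ be the monic Hahn multiple orthogonal polynomials and $P^{\vec\alpha,\alpha_0}_{\vec n}$ the monic multiple Jacobi polynomial on $[0,1]$. Then for every $x$, $$\lim_{N\to\infty}N^{-|\vec n|}H^{\vec\alpha,\alpha_0,N}_{\vec n}(Nx)=P^{\vec\alpha,\alpha_0}_{\vec n}(x).$$
   Context: $(a)_k=a(a+1)\cdots(a+k-1)$, $(a)_0=1$, is the Pochhammer symbol, $\nabla f(s)=f(s)-f(s-1)$, and $N$ runs over positive integers $N\ge|\vec n|$. The Hahn multiple orthogonal polynomial $H^{\vec\alpha,\alpha_0,N}_{\vec n}(s)$, $\vec\alpha=(\alpha_1,\dots,\alpha_r)$, is the monic polynomial of degree $|\vec n|$ in $s$ given by the Rodrigues-type formula (identity of meromorphic functions of $s$) $$H^{\vec\alpha,\alpha_0,N}_{\vec n}(s)=\frac{(-1)^{|\vec n|}}{\prod_{k=1}^r(|\vec n|+\alpha_0+\alpha_k+1)_{n_k}}\frac{\Gamma(s+1)\Gamma(N-s+1)}{\Gamma(\alpha_0+N-s+1)}\left(\prod_{i=1}^r\frac{1}{\Gamma(\alpha_i+s+1)}\nabla^{n_i}\Gamma(\alpha_i+n_i+s+1)\right)\frac{\Gamma(\alpha_0+N-s+1)}{\Gamma(s+1)\Gamma(N-|\vec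 n|-s+1)},$$ where the product is the composition of the operators $g\mapsto\frac{1}{\Gamma(\alpha_i+s+1)}\nabla^{n_i}\big(\Gamma(\alpha_i+n_i+s+1)g\big)$. The multiple Jacobi polynomial $P^{\vec\alpha,\alpha_0}_{\vec n}(x)$ is the monic polynomial of degree $|\vec n|$ given, for $x\in(0,1)$, by $$P^{\vec\alpha,\alpha_0}_{\vec n}(x)=\frac{(-1)^{|\vec n|}(1-x)^{-\alpha_0}}{\prod_{i=1}^r(|\vec n|+\alpha_0+\alpha_i+1)_{n_i}}\left(\prod_{i=1}^r x^{-\alpha_i}\frac{d^{n_i}}{dx^{n_i}}x^{\alpha_i+n_i}\right)(1-x)^{\alpha_0+|\vec n|},$$ where the product is again a composition of operators; it satisfies $\int_0^1P^{\vec\alpha,\alpha_0}_{\vec n}(x)x^{\alpha_i}(1-x)^{\alpha_0}x^k\,dx=0$ for $0\le k\le n_i-1$, $i=1,\dots,r$. *)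

(* Defs.v *)
From mathcomp Require Import all_boot all_order all_algebra.
From mathcomp Require Import complex.
From mathcomp Require Import all_classical all_reals all_analysis.

Set Implicit Arguments.
Unset Strict Implicit.
Unset Printing Implicit Defensive.

Import Order.TTheory GRing.Theory Num.Theory.
Import numFieldNormedType.Exports.

Local Open Scope classical_set_scope.
Local Open Scope ring_scope.
Local Open Scope complex_scope.

Definition pochhammer (K : pzRingType) (a : K) (k : nat) : K :=
  \prod_(j < k) (a + j%:R).

Definition multi_size (r : nat) (n : 'I_r -> nat) : nat := (\sum_(i < r) n i)%N.

Definition cexp (R : realType) (z : R[i]) : R[i] :=
  (expR (complex.Re z) * cos (complex.Im z)) +i*
  (expR (complex.Re z) * sin (complex.Im z)).

(* Gauss's product formula
     Gamma(z) = lim_m m! m^z / (z (z + 1) ... (z + m)),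
   valid for every complex z that is not a nonpositive integer; the value at
   those poles is meaningless.  R[i]^o carries the topology of the modulus. *)
Definition cGamma (R : realType) (z : R[i]) : R[i] :=
  lim ((fun m : nat => (m`!)%:R * cexp ((ln (m%:R : R))%:C * z)
                       / pochhammer z m.+1 : R[i]^o) @ \oo).

Definition nabla (K : pzRingType) (f : K -> K) (s : K) : K := f s - f (s - 1).

Definition hahn_op (R : realType) (a : R) (n : nat) (g : R[i] -> R[i])
    (s : R[i]) : R[i] :=
  (cGamma (a%:C + s + 1))^-1
  * iter n (@nabla _) (fun t => cGamma (a%:C + n%:R + t + 1) * g t) s.

(* The operators are composed left to right, index 0 being outermost. *)
Definition hahn_rodrigues (R : realType) (r : nat) (n : 'I_r -> nat)
    (alpha0 : R) (alpha : 'I_r -> R) (N : nat) (s : R[i]) : R[i] :=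
  (-1) ^+ multi_size n
  / \prod_(k < r)
      pochhammer ((multi_size n)%:R + alpha0%:C + (alpha k)%:C + 1) (n k)
  * (cGamma (s + 1) * cGamma (N%:R - s + 1) / cGamma (alpha0%:C + N%:R - s + 1))
  * (\big[comp/idfun]_(i < r) hahn_op (alpha i) (n i))
      (fun t => cGamma (alpha0%:C + N%:R - t + 1)
                / (cGamma (t + 1)
                   * cGamma (N%:R - (multi_size n)%:R - t + 1))) s.

Definition is_monic_of_degree (K : nzRingType) (d : nat) (p : {poly K})
    : Prop :=
  p \is monic /\ size p = d.+1.

(* The identity of meromorphic functions is imposed at every s such that none
   of s, s - alpha0, s + alpha_i is an integer: off this closed discrete set
   every Gamma factor occurring in the formula is finite. *)
Definition is_hahn (R : realType) (r : nat) (n : 'I_r -> nat)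
    (alpha0 : R) (alpha : 'I_r -> R) (N : nat) (H : {poly R[i]}) : Prop :=
  is_monic_of_degree (multi_size n) H /\
  forall s : R[i],
    (forall m : int, s != m%:~R) ->
    (forall m : int, s - alpha0%:C != m%:~R) ->
    (forall (i : 'I_r) (m : int), s + (alpha i)%:C != m%:~R) ->
    H.[s] = hahn_rodrigues n alpha0 alpha N s.

Definition jacobi_op (R : realType) (a : R) (n : nat) (g : R -> R) (x : R)
    : R :=
  x `^ (- a) * derive1n n (fun y : R => y `^ (a + n%:R) * g y) x.

Definition jacobi_rodrigues (R : realType) (r : nat) (n : 'I_r -> nat)
    (alpha0 : R) (alpha : 'I_r -> R) (x : R) : R :=
  (-1) ^+ multi_size n * (1 - x) `^ (- alpha0)
  / \prod_(i < r) pochhammer ((multi_size n)%:R + alpha0 + alpha i + 1) (n i)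
  * (\big[comp/idfun]_(i < r) jacobi_op (alpha i) (n i))
      (fun y => (1 - y) `^ (alpha0 + (multi_size n)%:R)) x.

Definition is_jacobi (R : realType) (r : nat) (n : 'I_r -> nat)
    (alpha0 : R) (alpha : 'I_r -> R) (P : {poly R[i]}) : Prop :=
  is_monic_of_degree (multi_size n) P /\
  forall x : R, 0 < x < 1 -> P.[x%:C] = (jacobi_rodrigues n alpha0 alpha x)%:C.

(* Main.v *)
Require Import Defs.
From mathcomp Require Import all_boot all_order all_algebra.
From mathcomp Require Import complex.
From mathcomp Require Import all_classical all_reals all_analysis.
From mathcomp Require Import ring.
Import Order.TTheory GRing.Theory Num.Theory.
Import numFieldNormedType.Exports.
Local Open Scope classical_set_scope.
Local Open Scope ring_scope.
Local Open Scope complex_scope.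
Set Implicit Arguments.
Unset Strict Implicit.
Unset Printing Implicit Defensive.

(** Both Rodrigues formulas are instances of one polynomial recursion with a
step e, where e = 1/N for Hahn and e = 0 for Jacobi.

Write W_m(t) = Gamma(b+N-t+1) / (Gamma(t+1) Gamma(N-m-t+1)), with b = alpha_0.
The Hahn formula starts from W_m with m = |n|, and the functional equation of
Gamma alone gives
  nabla (Gamma(a+t+1) W_m(t) p(t/N))
    = N Gamma(a+t) W_(m-1)(t) q(t/N),
where q is obtained from p by a first-order operator whose coefficients are
polynomial in e = 1/N [nabla_hahn_weight].  The derivative of
x^a (1-x)^(b+m) p(x) is x^(a-1) (1-x)^(b+m-1) q(x), where q is now obtained
from p by the same operator at e = 0 [is_derive_jacobi_weight].  The operator
is [ladder_step]; iterating it through all the factors of the Rodrigues formula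
gives a polynomial [rodrigues_poly] Q_e.  The Gamma factors outside the
operators cancel W_0, so with one and the same constant c,
  N^(-|n|) H_N(N x) = c Q_(1/N)(x)   and   P(x) = c Q_0(x).
For fixed x the value Q_e(x) is a polynomial in e [rodrigues_poly_family], hence
is continuous at e = 0, and the limit follows.

A polynomial is determined by its values at infinitely many points, so the two
formulas are only compared at the translates s0 + k of one suitable real s0, and
at points of ]0, 1[.  Consequently Gamma is needed only at real nonintegral
arguments: there Gauss's sequence has a nonzero limit, which satisfies
Gamma(x+1) = x Gamma(x) [gamma_seq_cvg], [cGammaD1]. *)

(** * The common polynomial recursion *)

(** The quotient (p(x) - p(x - e)) / e, written as a polynomial in x and e by
expanding the differences of powers, so that it makes sense at e = 0. *)
Definition bwd_quot (K : comNzRingType) (e : K) (p : {poly K}) : {poly K} :=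
  \sum_(k < size p)
    p`_k *: \sum_(i < k) 'X ^+ (k.-1 - i) * ('X - e%:P) ^+ i.

Lemma bwd_quotE (K : comNzRingType) (e : K) (p : {poly K}) (x : K) :
  e * (bwd_quot e p).[x] = p.[x] - p.[x - e].
Proof.
rewrite [p.[x]]horner_coef [p.[x - e]]horner_coef -sumrB /bwd_quot.
rewrite horner_sum mulr_sumr.
apply: eq_bigr => k _; rewrite hornerZ mulrCA -mulrBr; congr (_ * _).
rewrite horner_sum subrXX subKr; congr (_ * _); apply: eq_bigr => i _.
by rewrite hornerM hornerXn horner_exp !hornerE.
Qed.

(** With e = 0 the k products of powers expanding the k-th difference all become
'X^(k-1), which produces the factor k of the derivative. *)
Lemma bwd_quot0 (K : comNzRingType) (p : {poly K}) : bwd_quot 0 p = p^`().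
Proof.
rewrite -[in RHS](coefK p) poly_def raddf_sum; apply: eq_bigr => k _ /=.
rewrite derivZ derivXn; congr (_ *: _).
rewrite polyC0 subr0 (eq_bigr (fun=> 'X ^+ k.-1)) ?sumr_const ?card_ord//.
by move=> i _; rewrite -exprD subnK// -ltnS (ltn_predK (ltn_ord i)).
Qed.

(** The morphism may lower the degree, so the two sums have different lengths;
the extra terms on the left have coefficients that f sends to 0. *)
Lemma map_bwd_quot (K L : comNzRingType) (f : {rmorphism K -> L}) (e : K)
    (p : {poly K}) :
  map_poly f (bwd_quot e p) = bwd_quot (f e) (map_poly f p).
Proof.
rewrite /bwd_quot raddf_sum /=.
under eq_bigr => k _.
  rewrite map_polyZ raddf_sum /=.
  under eq_bigr => i _ do
    rewrite rmorphM !rmorphXn /= rmorphB /= map_polyX map_polyC.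
  over.
rewrite [RHS](big_ord_widen_cond _ xpredT (fun k => (map_poly f p)`_k
  *: \sum_(i < k) 'X ^+ (k.-1 - i) * ('X - (f e)%:P) ^+ i) (size_poly _ _)).
rewrite [LHS](bigID (fun k : 'I__ => (k < size (map_poly f p))%N)) /=.
rewrite [X in _ + X]big1 ?addr0; last first.
  move=> k; rewrite -leqNgt -coef_map => /(nth_default 0) ->.
  by rewrite scale0r.
by apply: eq_bigr => k _; rewrite coef_map.
Qed.

(** This is
  ((a e + x) (1 - x - (m-1) e) p(x) - x (1 - x + (b+1) e) p(x - e)) / e
with the division carried out, see [ladder_stepE]; the written form exists for
every e, is polynomial in e, and at e = 0 is the differential operator that
acts on p when x^a (1-x)^(m+b) p is differentiated. *)
Definition ladder_step (K : comNzRingType) (e b a m : K) (p : {poly K}) :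
    {poly K} :=
  (a *: (1 - 'X) - (a * (m - 1) * e)%:P - (m + b) *: 'X) * p
  + 'X * (1 - 'X + ((b + 1) * e)%:P) * bwd_quot e p.

Lemma ladder_stepE (K : comNzRingType) (e b a m x : K) (p : {poly K}) :
  e * (ladder_step e b a m p).[x]
  = (a * e + x) * (1 - x - (m - 1) * e) * p.[x]
    - x * (1 - x + (b + 1) * e) * p.[x - e].
Proof.
rewrite /ladder_step !(hornerE, hornerZ).
have -> : p.[x - e] = p.[x] - e * (bwd_quot e p).[x] by rewrite bwd_quotE subKr.
ring.
Qed.

Lemma ladder_step0 (K : comNzRingType) (b a m : K) (p : {poly K}) :
  ladder_step 0 b a m p
  = (a *: (1 - 'X) - (m + b) *: 'X) * p + 'X * (1 - 'X) * p^`().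
Proof. by rewrite /ladder_step bwd_quot0 !mulr0 !polyC0 subr0 addr0. Qed.

(** One factor of a Rodrigues formula: every differentiation lowers by one both
the exponent a and the exponent m. *)
Fixpoint ladder (K : comNzRingType) (e b : K) (k : nat) (a m : K)
    (p : {poly K}) : {poly K} :=
  if k is k'.+1
  then ladder_step e b (a - k'%:R) (m - k'%:R) (ladder e b k' a m p) else p.

(** The head of s is the outermost operator.  The operators further inside
lower m first, from c plus the sum of all the orders, so that m has become
c + n when the head (a, n) is applied, and c at the end. *)
Fixpoint rodrigues_poly (K : comNzRingType) (e b : K) (s : seq (K * nat))
    (c : K) : {poly K} :=
  if s is (a, n) :: s'
  then ladder e b n (a + n%:R) (c + n%:R) (rodrigues_poly e b s' (c + n%:R))
  else 1.

Section RodriguesMorphism.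
Variables (K L : comNzRingType) (f : {rmorphism K -> L}).

Lemma map_ladder_step e b a m p :
  map_poly f (ladder_step e b a m p)
  = ladder_step (f e) (f b) (f a) (f m) (map_poly f p).
Proof.
(* The constants are abstracted so that polyC is not distributed over them. *)
have map_form u v w t q : map_poly f ((u *: (1 - 'X) - v%:P - w *: 'X) * p
    + 'X * (1 - 'X + t%:P) * q)
    = (f u *: (1 - 'X) - (f v)%:P - f w *: 'X) * map_poly f p
      + 'X * (1 - 'X + (f t)%:P) * map_poly f q.
  rewrite !(rmorphD, rmorphM, rmorphN) /= !map_polyZ !map_polyC /= map_polyX.
  by rewrite rmorphB /= !rmorph1 map_polyX.
rewrite /ladder_step map_form map_bwd_quot.
by rewrite !(rmorphD, rmorphM, rmorphN) rmorph1.
Qed.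

Lemma map_ladder e b k a m p :
  map_poly f (ladder e b k a m p)
  = ladder (f e) (f b) k (f a) (f m) (map_poly f p).
Proof.
by elim: k => //= k IH; rewrite map_ladder_step IH !rmorphB /= rmorph_nat.
Qed.

Lemma map_rodrigues_poly e b s c :
  map_poly f (rodrigues_poly e b s c)
  = rodrigues_poly (f e) (f b) [seq (f u.1, u.2) | u <- s] (f c).
Proof.
elim: s c => [|[a n] s IH] c /=; first by rewrite rmorph1.
by rewrite map_ladder IH !rmorphD /= rmorph_nat.
Qed.

End RodriguesMorphism.

(** Run the recursion over the ring of polynomials in e, with the variable as
step; evaluation at a given e is a ring morphism, which carries this generic
value to the one for the step e. *)
Lemma rodrigues_poly_family (K : comNzRingType) (b : K) (s : seq (K * nat))
    (c x : K) :
  exists q : {poly K}, forall e, (rodrigues_poly e b s c).[x] = q.[e].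
Proof.
pose Q := rodrigues_poly 'X b%:P [seq (u.1%:P, u.2) | u <- s] c%:P.
exists Q.[x%:P] => e; rewrite -[RHS]/(horner_eval e Q.[x%:P]).
have -> : horner_eval e Q.[x%:P]
    = (map_poly (horner_eval e) Q).[horner_eval e x%:P] by rewrite horner_map.
rewrite map_rodrigues_poly /= /horner_eval !hornerC hornerX -map_comp.
congr (rodrigues_poly _ _ _ _).[_]; rewrite -[LHS]map_id.
by apply: eq_map => -[a n] /=; rewrite hornerC.
Qed.

Lemma poly_eq_seq (K : idomainType) (p q : {poly K}) (u : nat -> K) :
  injective u -> (forall k, p.[u k] = q.[u k]) -> p = q.
Proof.
move=> u_inj pq; apply/eqP; rewrite -subr_eq0; apply/eqP.
apply: (@roots_geq_poly_eq0 _ _ (mkseq u (size (p - q)))).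
- by apply/allP => _ /mapP[k _ ->]; rewrite rootE !hornerE pq subrr.
- by rewrite map_inj_uniq ?iota_uniq.
- by rewrite size_mkseq.
Qed.

(** * The Gamma function at nonintegral reals *)

Section GammaReal.
Variable R : realType.
Implicit Types (x : R) (m : nat).

(** On real numbers the modulus is the absolute value. *)
Lemma cvg_real_complex (u : nat -> R) (l : R) :
  u @ \oo --> l -> (fun m => (u m)%:C : R[i]^o) @ \oo --> (l%:C : R[i]^o).
Proof.
move=> ul; apply/cvgrPdist_lt => e e0.
have e_real : e = (complex.Re e)%:C by rewrite RRe_real// gtr0_real.
have Re0 : 0 < complex.Re e by rewrite -ltcR -e_real.
move/cvgrPdist_lt : ul => /(_ _ Re0); apply: filterS => m.
rewrite -rmorphB /= normc_def /= expr0n addr0 sqrtr_sqr e_real ltcR.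
exact.
Qed.

(** Gauss's sequence for Gamma(x). *)
Definition gamma_seq x m : R :=
  (m`!)%:R * expR (ln (m%:R : R) * x) / pochhammer x m.+1.

Lemma pochhammerS (K : pzRingType) (a : K) k :
  pochhammer a k.+1 = pochhammer a k * (a + k%:R).
Proof. by rewrite /pochhammer big_ord_recr. Qed.

Lemma pochhammerSl (K : pzRingType) (a : K) k :
  pochhammer a k.+1 = a * pochhammer (a + 1) k.
Proof.
rewrite /pochhammer big_ord_recl addr0; congr (_ * _); apply: eq_bigr => i _.
by rewrite /= /bump /= natrD addrA.
Qed.

Lemma rmorph_pochhammer (K L : pzRingType) (f : {rmorphism K -> L}) a k :
  f (pochhammer a k) = pochhammer (f a) k.
Proof.
elim: k => [|k IH]; first by rewrite /pochhammer !big_ord0 rmorph1.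
by rewrite !pochhammerS rmorphM rmorphD /= IH rmorph_nat.
Qed.

Lemma pochhammer_gt0 x k : 0 < x -> 0 < pochhammer x k.
Proof. by move=> x0; apply: prodr_gt0 => i _; rewrite ltr_wpDr. Qed.

Lemma pochhammer_neq0 x k : x \isn't a Num.int -> pochhammer x k != 0.
Proof.
move=> xZ; apply/prodf_neq0 => i _; apply: contra xZ => /eqP xi.
rewrite (_ : x = - i%:R) ?rpredN ?rpred_nat//.
by apply/eqP; rewrite -addr_eq0 xi.
Qed.

Lemma gamma_seq_gt0 x m : 0 < x -> 0 < gamma_seq x m.
Proof.
move=> x0; rewrite /gamma_seq divr_gt0 ?pochhammer_gt0//.
by rewrite mulr_gt0 ?expR_gt0// ltr0n fact_gt0.
Qed.

Lemma gamma_seqS x m : 0 < x -> gamma_seq x m.+1 =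
  gamma_seq x m * (m.+1%:R / (x + m.+1%:R)
                   * expR ((ln m.+1%:R - ln m%:R) * x)).
Proof.
move=> x0; rewrite /gamma_seq [pochhammer x m.+2]pochhammerS factS natrM.
have -> : ln (m.+1%:R : R) * x = ln (m%:R : R) * x + (ln m.+1%:R - ln m%:R) * x.
  by rewrite -mulrDl addrC subrK.
rewrite expRD; field.
by rewrite !gt_eqF ?pochhammer_gt0// ltr_wpDr.
Qed.

Lemma ln_succ_bounds m : (0 < m)%N ->
  m.+1%:R^-1 <= ln (m.+1%:R : R) - ln m%:R <= m%:R^-1.
Proof.
move=> m0; have mR : 0 < m%:R :> R by rewrite ltr0n.
have SR : 0 < m.+1%:R :> R by rewrite ltr0n.
have mS : m.+1%:R = m%:R + 1 :> R by rewrite natr1.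
have M0 : m%:R != 0 :> R by rewrite gt_eqF.
have S0 : m%:R + 1 != 0 :> R by rewrite -mS gt_eqF.
rewrite -ln_div//; apply/andP; split; last first.
  have -> : m.+1%:R / m%:R = 1 + m%:R^-1 :> R by rewrite mS; field.
  by rewrite le_ln1Dx// (lt_trans (ltrN10 _))// invr_gt0.
rewrite -[ln _]opprK -lnV ?posrE ?divr_gt0// lerNr invf_div.
have -> : m%:R / m.+1%:R = 1 + - m.+1%:R^-1 :> R by rewrite mS; field.
by rewrite le_ln1Dx// ltrN2 invf_lt1// ltr1n.
Qed.

(** The ratio of consecutive terms is (1 + 1/m)^x / (1 + x/(m+1)), and
(1 + 1/m)^x >= exp (x/(m+1)) >= 1 + x/(m+1). *)
Lemma gamma_seq_nondecreasing x m : 0 < x -> (0 < m)%N ->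
  gamma_seq x m <= gamma_seq x m.+1.
Proof.
move=> x0 m0; have /andP[L_ge _] := ln_succ_bounds m0.
have S0 : 0 < m.+1%:R :> R by rewrite ltr0n.
have xS0 : 0 < x + m.+1%:R by rewrite addr_gt0.
rewrite gamma_seqS//; apply: ler_peMr; first by rewrite ltW ?gamma_seq_gt0.
rewrite mulrAC ler_pdivlMr// mul1r mulrC -ler_pdivrMr//.
apply: le_trans (expR_ge1Dx _); rewrite mulrDl divff ?gt_eqF// addrC lerD2l.
by rewrite [leRHS]mulrC ler_pM2l.
Qed.

(** A nonincreasing majorant of Gauss's sequence, which yields its boundedness.
The ratio of consecutive terms is at most exp (x/m - x/(x+m+1)), and this
exponent is x(x+1)/(m(x+m+1)), which is at most x(x+1) (1/m - 1/(m+1)). *)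
Lemma gamma_seq_corrected x m : 0 < x -> (0 < m)%N ->
  gamma_seq x m.+1 * expR (x * (x + 1) / m.+1%:R)
  <= gamma_seq x m * expR (x * (x + 1) / m%:R).
Proof.
move=> x0 m0; have /andP[_ L_le] := ln_succ_bounds m0.
have M0 : 0 < m%:R :> R by rewrite ltr0n.
have S0 : 0 < m.+1%:R :> R by rewrite ltr0n.
have xS0 : 0 < x + m.+1%:R by rewrite addr_gt0.
rewrite gamma_seqS// -[leLHS]mulrA ler_pM2l ?gamma_seq_gt0//.
have -> : m.+1%:R / (x + m.+1%:R) = 1 + - (x / (x + m.+1%:R)) :> R.
  by apply/eqP; rewrite eq_sym subr_eq -mulrDl [_ + x]addrC divff// gt_eqF.
apply: (@le_trans _ _ (expR (- (x / (x + m.+1%:R))) * expR (m%:R^-1 * x)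
                       * expR (x * (x + 1) / m.+1%:R))).
  rewrite ler_pM2r ?expR_gt0// ler_pM ?expR_ge0 ?expR_ge1Dx//.
    by rewrite subr_ge0 ler_pdivrMr// mul1r lerDl ltW.
  by rewrite ler_expR ler_pM2r.
rewrite -!expRD ler_expR -subr_ge0.
have -> : x * (x + 1) / m%:R - (- (x / (x + m.+1%:R)) + m%:R^-1 * x
            + x * (x + 1) / m.+1%:R)
          = x ^+ 2 * (x + 1) / (m%:R * m.+1%:R * (x + m.+1%:R)).
  move: M0 S0 xS0; rewrite -natr1; move: (m%:R : R) => M M0 S0 xS0; field.
  by rewrite !gt_eqF.
by rewrite divr_ge0 ?mulr_ge0 ?ltW// ltr_wpDr.
Qed.

Lemma gamma_seq_cvg_pos x : 0 < x ->
  exists2 l : R, l != 0 & gamma_seq x @ \oo --> l.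
Proof.
move=> x0; (* Index 0 is skipped: the ratio bounds hold from index 1 on. *)
pose u m := gamma_seq x m.+1.
have u_nd : nondecreasing_seq u.
  by apply/nondecreasing_seqP => m; exact: gamma_seq_nondecreasing.
have u_ub m : u m <= gamma_seq x 1 * expR (x * (x + 1) / 1%:R).
  apply: (@le_trans _ _ (gamma_seq x m.+1 * expR (x * (x + 1) / m.+1%:R))).
    apply: ler_peMr; first by rewrite ltW ?gamma_seq_gt0.
    rewrite -expR0 ltW// ltr_expR.
    by rewrite divr_gt0 ?mulr_gt0 ?addr_gt0// ltr0n.
  by elim: m => // m IH; apply: le_trans IH; exact: gamma_seq_corrected.
have u_cvg : cvgn u.
  apply: nondecreasing_is_cvgn => //.
  by exists (gamma_seq x 1 * expR (x * (x + 1) / 1%:R)) => _ [m _ <-].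
exists (limn u); last by rewrite -(cvg_shiftS (gamma_seq x)).
rewrite gt_eqF//; apply: lt_le_trans (gamma_seq_gt0 1 x0) _.
exact: (nondecreasing_cvgn_le u_nd u_cvg 0).
Qed.

Lemma gamma_seq_shift x m : x \isn't a Num.int -> (0 < m)%N ->
  gamma_seq (x + 1) m * (1 + (x + 1) / m%:R) = x * gamma_seq x m.
Proof.
move=> xZ m0; have M0 : m%:R != 0 :> R by rewrite pnatr_eq0 -lt0n.
have xN0 : x != 0 by apply: contra xZ => /eqP->.
have x1Z : x + 1 \isn't a Num.int by rewrite rpredDr// rpred1.
have P0 : pochhammer (x + 1) m.+1 != 0 by rewrite pochhammer_neq0.
have P1 : pochhammer (x + 1) m != 0 by rewrite pochhammer_neq0.
have x1m : x + 1 + m%:R != 0.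
  by move: P0; rewrite pochhammerS mulf_eq0 negb_or => /andP[].
have ln_split : expR (ln m%:R * (x + 1)) = expR (ln m%:R * x) * m%:R.
  by rewrite mulrDr mulr1 expRD lnK// posrE ltr0n.
rewrite /gamma_seq pochhammerS pochhammerSl ln_split.
by field; rewrite M0 P1 xN0 x1m.
Qed.

(** Negative arguments are reached from positive ones, one unit at a time, by
[gamma_seq_shift] read from right to left. *)
Lemma gamma_seq_cvg x : x \isn't a Num.int ->
  exists2 l : R, l != 0 & gamma_seq x @ \oo --> l.
Proof.
have [k] : exists k : nat, 0 < x + k%:R.
  exists (Num.Def.truncn `|x|).+1.
  rewrite -ltrBlDl sub0r (le_lt_trans _ (truncnS_gt _))//.
  by rewrite -normrN ler_norm.
elim: k x => [|k IH] x xk xZ.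
  by apply: gamma_seq_cvg_pos; rewrite addr0 in xk.
have x1Z : x + 1 \isn't a Num.int by rewrite rpredDr// rpred1.
have xN0 : x != 0 by apply: contra xZ => /eqP->.
have [|l l0 lP] := IH (x + 1) _ x1Z.
  by rewrite -addrA -[1 + _]/(1%:R + _) -natrD.
exists (x^-1 * (l * (1 + (x + 1) * 0))).
  by rewrite mulr0 addr0 mulr1 mulf_neq0 ?invr_eq0.
have : (fun m => x^-1 * (gamma_seq (x + 1) m * (1 + (x + 1) * m%:R^-1)))
    @ \oo --> x^-1 * (l * (1 + (x + 1) * 0)).
  apply: cvgMr; apply: cvgM => //; apply: cvgD; first exact: cvg_cst.
  by apply: cvgMr; rewrite -cvg_shiftS; exact: cvg_harmonic.
apply: cvg_trans; apply: near_eq_cvg; near=> m.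
by rewrite gamma_seq_shift ?mulKf//; near: m; exact: nbhs_infty_gt.
Unshelve. all: by end_near. Qed.

Lemma cGamma_real x (l : R) : gamma_seq x @ \oo --> l -> cGamma x%:C = l%:C.
Proof.
move=> /cvg_real_complex xl; rewrite /cGamma.
apply: (@cvg_lim R[i]^o) => //.
apply: cvg_trans xl; apply: near_eq_cvg; near=> m.
rewrite /gamma_seq /cexp /= !mul0r mulr0 addr0 cos0 sin0 !mulr0 subr0 mulr1.
by rewrite !rmorphM /= fmorphV rmorph_pochhammer rmorph_nat.
Unshelve. all: by end_near. Qed.

Lemma cGamma_neq0 x : x \isn't a Num.int -> cGamma x%:C != 0.
Proof.
move=> /gamma_seq_cvg[l l0 /cGamma_real ->].
by rewrite (inj_eq (@complexI R) l 0).
Qed.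

Lemma cGammaD1 x : x \isn't a Num.int ->
  cGamma (x%:C + 1) = x%:C * cGamma x%:C.
Proof.
move=> xZ; have x1Z : x + 1 \isn't a Num.int by rewrite rpredDr// rpred1.
have [l _ xl] := gamma_seq_cvg xZ; have [l' _ xl'] := gamma_seq_cvg x1Z.
have -> : x%:C + 1 = (x + 1)%:C by rewrite rmorphD rmorph1.
rewrite (cGamma_real xl) (cGamma_real xl') -rmorphM; congr (_%:C).
have A : (fun m => gamma_seq (x + 1) m * (1 + (x + 1) * m%:R^-1))
    @ \oo --> l' * (1 + (x + 1) * 0).
  apply: cvgM => //; apply: cvgD; first exact: cvg_cst.
  by apply: cvgMr; rewrite -cvg_shiftS; exact: cvg_harmonic.
rewrite mulr0 addr0 mulr1 in A.
rewrite -(cvg_lim (@Rhausdorff R) A); apply: (cvg_lim (@Rhausdorff R)).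
have : (fun m => x * gamma_seq x m) @ \oo --> x * l by exact: cvgMr.
apply: cvg_trans; apply: near_eq_cvg; near=> m.
by rewrite gamma_seq_shift//; near: m; exact: nbhs_infty_gt.
Unshelve. all: by end_near. Qed.

End GammaReal.

(** * The Hahn side *)

Section Nonint.
Variable R : realType.

(** Gamma is controlled on this class of numbers, which is stable under integer
translations and opposites. *)
Definition nonint (z : R[i]) : Prop :=
  exists2 x : R, z = x%:C & x \isn't a Num.int.

Lemma nonint_neq0 z : nonint z -> z != 0.
Proof.
case=> x -> xZ; rewrite (inj_eq (@complexI R) x 0).
by apply: contra xZ => /eqP ->; rewrite rpred0.
Qed.

Lemma nonintDz z (m : int) : nonint z -> nonint (z + m%:~R).
Proof.
case=> x -> xZ; exists (x + m%:~R); first by rewrite rmorphD /= rmorph_int.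
by rewrite rpredDr// rpred_int.
Qed.

Lemma nonintDn z (k : nat) : nonint z -> nonint (z + k%:R).
Proof. exact: (@nonintDz z k). Qed.

Lemma nonintBn z (k : nat) : nonint z -> nonint (z - k%:R).
Proof. by move=> /(@nonintDz z (- k%:Z)); rewrite rmorphN. Qed.

Lemma nonintD1 z : nonint z -> nonint (z + 1).
Proof. exact: (@nonintDn z 1). Qed.

Lemma nonintB1 z : nonint z -> nonint (z - 1).
Proof. exact: (@nonintBn z 1). Qed.

Lemma nonintN z : nonint z -> nonint (- z).
Proof. by case=> x -> xZ; exists (- x); rewrite ?rmorphN ?rpredN. Qed.

Lemma nonint_cGamma_neq0 z : nonint z -> cGamma z != 0.
Proof. by case=> x -> xZ; exact: cGamma_neq0. Qed.

Lemma nonint_cGammaD1 z : nonint z -> cGamma (z + 1) = z * cGamma z.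
Proof. by case=> x -> xZ; exact: cGammaD1. Qed.

End Nonint.

Section Hahn.
Variable R : realType.
Implicit Types (a b m N s t : R[i]) (p : {poly R[i]}).

Definition hahn_weight b N m t : R[i] :=
  cGamma (b + N - t + 1) / (cGamma (t + 1) * cGamma (N - m - t + 1)).

(** The functional equation expresses every Gamma factor at s - 1 and at s
through the same four values, and what remains is the numerator in
[ladder_stepE] at x = s/N and e = 1/N.  The scalar A collects the powers of N
produced by earlier steps. *)
Lemma nabla_hahn_weight A b N a m p s :
  N != 0 -> nonint s -> nonint (b + N - s) -> nonint (N - m - s) ->
  nonint (a + s) ->
  nabla (fun t =>
    cGamma (a + t + 1) * (A * (hahn_weight b N m t * p.[t / N]))) s
  = cGamma (a + s)
    * (N * A * (hahn_weight b N (m - 1) s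
                * (ladder_step N^-1 b a m p).[s / N])).
Proof.
move=> N0 sZ bZ mZ aZ; rewrite /nabla /hahn_weight.
have -> : a + (s - 1) + 1 = a + s by ring.
have -> : b + N - (s - 1) + 1 = b + N - s + 1 + 1 by ring.
have -> : s - 1 + 1 = s by ring.
have -> : N - m - (s - 1) + 1 = N - m - s + 1 + 1 by ring.
have -> : N - (m - 1) - s + 1 = N - m - s + 1 + 1 by ring.
have -> : (s - 1) / N = s / N - N^-1 by rewrite mulrBl mul1r.
rewrite (nonint_cGammaD1 aZ) (nonint_cGammaD1 sZ).
rewrite (nonint_cGammaD1 (nonintD1 bZ)) (nonint_cGammaD1 (nonintD1 mZ)).
have step_eq : (ladder_step N^-1 b a m p).[s / N]
    = N * ((a / N + s / N) * (1 - s / N - (m - 1) / N) * p.[s / N]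
           - s / N * (1 - s / N + (b + 1) / N) * p.[s / N - N^-1]).
  by rewrite -ladder_stepE mulVKf.
rewrite step_eq.
have := nonint_neq0 sZ; have := nonint_neq0 (nonintD1 mZ).
have := nonint_cGamma_neq0 sZ; have := nonint_cGamma_neq0 (nonintD1 mZ).
move: (cGamma _) (cGamma _) (cGamma _) (cGamma _) (p.[_]) (p.[_]).
move=> G1 G2 G3 G4 p1 p2 *; field.
by apply/and5P; split.
Qed.

Lemma iter_nabla_hahn_weight A b N a m p k s :
  N != 0 -> nonint s -> nonint (b + N - s) -> nonint (N - m - s) ->
  nonint (a + s) ->
  iter k (@nabla _)
    (fun t => cGamma (a + t + 1) * (A * (hahn_weight b N m t * p.[t / N]))) s
  = cGamma (a - k%:R + s + 1)
    * (N ^+ k * A * (hahn_weight b N (m - k%:R) s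
                     * (ladder N^-1 b k a m p).[s / N])).
Proof.
move=> N0; elim: k s => [|k IH] s sZ bZ mZ aZ /=.
  by rewrite !subr0 expr0 mul1r.
rewrite [LHS]/nabla !IH//.
- rewrite -[LHS]/(nabla (fun t => cGamma (a - k%:R + t + 1)
    * (N ^+ k * A * (hahn_weight b N (m - k%:R) t
                     * (ladder N^-1 b k a m p).[t / N]))) s).
  rewrite nabla_hahn_weight//; first last.
  + by rewrite addrAC; exact: nonintBn.
  + rewrite (_ : _ - _ = N - m - s + k%:R); last by ring.
    exact: nonintDn.
  rewrite -natr1 exprS.
  have -> : a - (k%:R + 1) + s + 1 = a - k%:R + s by ring.
  have -> : m - (k%:R + 1) = m - k%:R - 1 by ring.
  by rewrite [N * (_ * A)]mulrA.
- exact: nonintB1.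
- by rewrite opprB addrCA addrC; exact: nonintD1.
- by rewrite opprB addrCA addrC; exact: nonintD1.
- by rewrite addrA; exact: nonintB1.
Qed.

(** Iterates of nabla at s only see s, s - 1, s - 2, and so on, so an identity
valid off the poles is enough to rewrite inside them. *)
Lemma eq_iter_nabla (S : R[i] -> Prop) (f g : R[i] -> R[i]) k s :
  (forall t, S t -> S (t - 1)) -> (forall t, S t -> f t = g t) -> S s ->
  iter k (@nabla _) f s = iter k (@nabla _) g s.
Proof.
move=> SB fg; elim: k s => [|k IH] s Ss /=; first exact: fg.
by rewrite /nabla !IH//; exact: SB.
Qed.

Lemma hahn_op_weight (S : R[i] -> Prop) (al : R) (n : nat) A b N m p
    (g : R[i] -> R[i]) s :
  N != 0 -> (forall t, S t -> S (t - 1)) ->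
  (forall t, S t -> [/\ nonint t, nonint (b + N - t), nonint (N - m - t)
                      & nonint (al%:C + t)]) ->
  (forall t, S t -> g t = A * (hahn_weight b N m t * p.[t / N])) -> S s ->
  hahn_op al n g s
  = N ^+ n * A * (hahn_weight b N (m - n%:R) s
                  * (ladder N^-1 b n (al%:C + n%:R) m p).[s / N]).
Proof.
move=> N0 SB SZ gE Ss; have [sZ bZ mZ aZ] := SZ _ Ss.
rewrite /hahn_op (eq_iter_nabla (S := S) (g := fun t =>
  cGamma (al%:C + n%:R + t + 1) * (A * (hahn_weight b N m t * p.[t / N]))))//;
  last by move=> t St; rewrite gE.
rewrite iter_nabla_hahn_weight//; last by rewrite addrAC; exact: nonintDn.
rewrite addrK mulKf//; apply: nonint_cGamma_neq0.
exact: nonintD1.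
Qed.

(** The real points at which the Hahn identity is imposed, b being alpha_0. *)
Definition admissible b (l : seq (R * nat)) t : Prop :=
  [/\ nonint t, nonint (t - b) & forall u, u \in l -> nonint (u.1%:C + t)].

Lemma admissibleB1 b l t : admissible b l t -> admissible b l (t - 1).
Proof.
case=> tZ bZ lZ; split; first exact: nonintB1.
  by rewrite addrAC; exact: nonintB1.
by move=> u /lZ uZ; rewrite addrA; exact: nonintB1.
Qed.

(** In a composition of the operators, an order m = c + sum of the orders is
lowered to m = c, and each unit of order contributes a factor N. *)
Lemma hahn_ops_weight b (N : nat) (l : seq (R * nat)) (c : nat) s :
  (0 < N)%N -> admissible b l s ->
  foldr (fun u => hahn_op u.1 u.2)
    (hahn_weight b N%:R (c + sumn (unzip2 l))%:R) l s
  = N%:R ^+ sumn (unzip2 l)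
    * (hahn_weight b N%:R c%:R s
       * (rodrigues_poly N%:R^-1 b
            [seq (u.1%:C, u.2) | u <- l] c%:R).[s / N%:R]).
Proof.
move=> N0; have NC0 : N%:R != 0 :> R[i] by rewrite pnatr_eq0 -lt0n.
elim: l c s => [|[al n] l IH] c s /=.
  by rewrite addn0 hornerC mulr1 mul1r.
move=> sA; rewrite addnA -natrD.
rewrite (@hahn_op_weight (admissible b ((al, n) :: l)) al n
  (N%:R ^+ sumn (unzip2 l)) b N%:R (c + n)%:R
  (rodrigues_poly N%:R^-1 b [seq (u.1%:C, u.2) | u <- l] (c + n)%:R))//.
- by rewrite exprD natrD addrK.
- exact: admissibleB1.
- move=> t [tZ bZ lZ]; split => //.
  + rewrite (_ : _ - _ = - (t - b) + N%:R); last by ring.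
    by apply: nonintDn; exact: nonintN.
  + rewrite (_ : _ - _ = - t + N%:R - (c + n)%:R); last by ring.
    by apply: nonintBn; apply: nonintDn; exact: nonintN.
  + exact: (lZ (al, n) (mem_head _ _)).
- move=> t [tZ bZ lZ]; apply: IH; split => // u ul.
  by apply: lZ; rewrite inE ul orbT.
Qed.

End Hahn.

Section Multi.
Variables (R : realType) (r : nat) (n : 'I_r -> nat) (alpha0 : R).
Variable (alpha : 'I_r -> R).

(** A list rather than a family indexed by 'I_r, so that the composition of
operators can be studied by plain induction. *)
Definition multi_seq : seq (R * nat) :=
  [seq (alpha i, n i) | i <- index_enum 'I_r].

Lemma sumn_multi_seq : sumn (unzip2 multi_seq) = multi_size n.
Proof.
by rewrite /multi_size sumnE /multi_seq /unzip2 -map_comp big_map.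
Qed.

Lemma big_comp_foldr (I T : Type) (F : I -> T -> T) (l : seq I) (g : T) :
  (\big[comp/idfun]_(i <- l) F i) g = foldr F g l.
Proof. by elim: l => [|i l IH]; rewrite ?big_nil// big_cons /= IH. Qed.

Lemma big_comp_multi (T : Type) (F : R -> nat -> T -> T) (g : T) :
  (\big[comp/idfun]_(i < r) F (alpha i) (n i)) g
  = foldr (fun u => F u.1 u.2) g multi_seq.
Proof. by rewrite big_comp_foldr foldr_map. Qed.

Definition rodrigues_const : R :=
  (-1) ^+ multi_size n
  / \prod_(i < r) pochhammer ((multi_size n)%:R + alpha0 + alpha i + 1) (n i).

(** The prefactor of the Rodrigues formula is the inverse of the weight of order
0, which is what the operators leave. *)
Lemma hahn_rodriguesE (N : nat) (s : R[i]) : (0 < N)%N ->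
  admissible alpha0%:C multi_seq s ->
  hahn_rodrigues n alpha0 alpha N s
  = rodrigues_const%:C * N%:R ^+ multi_size n
    * (rodrigues_poly N%:R^-1 alpha0%:C
         [seq (u.1%:C, u.2) | u <- multi_seq] 0).[s / N%:R].
Proof.
move=> N0 sA; have [sZ bZ _] := sA; rewrite /hahn_rodrigues big_comp_multi.
have := hahn_ops_weight 0 N0 sA; rewrite add0n sumn_multi_seq => ->.
have -> : (-1) ^+ multi_size n / \prod_(k < r)
      pochhammer ((multi_size n)%:R + alpha0%:C + (alpha k)%:C + 1) (n k)
    = rodrigues_const%:C.
  rewrite /rodrigues_const rmorphM /= rmorphXn /= rmorphN rmorph1 fmorphV.
  rewrite rmorph_prod; congr (_ / _); apply: eq_bigr => i _.
  by rewrite rmorph_pochhammer !rmorphD /= rmorph_nat rmorph1.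
rewrite /hahn_weight subr0 -!mulrA; congr (_ * _).
have NsZ : nonint (N%:R - s) by rewrite addrC; apply/nonintDn/nonintN.
have bNsZ : nonint (alpha0%:C + N%:R - s).
  rewrite (_ : _ - _ = - (s - alpha0%:C) + N%:R); last by ring.
  exact/nonintDn/nonintN.
have := nonint_cGamma_neq0 (nonintD1 sZ).
have := nonint_cGamma_neq0 (nonintD1 NsZ).
have := nonint_cGamma_neq0 (nonintD1 bNsZ).
by move=> *; field; apply/and3P; split.
Qed.

End Multi.

Section AvoidInt.
Variable R : realType.

(** Modulo integers each c forbids exactly one value in [0, 1[, so among
(size l).+1 distinct points of this interval one is allowed. *)
Lemma exists_avoid_int (l : seq R) :
  exists x : R, forall c, c \in l -> x + c \isn't a Num.int.
Proof.
pose frac (c : R) := - c - (Num.floor (- c))%:~R.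
pose pts : seq R := mkseq (fun j => j.+2%:R^-1) (size l).+1.
have pts_uniq : uniq pts.
  rewrite map_inj_uniq ?iota_uniq// => i j /invr_inj /eqP.
  by rewrite eqr_nat => /eqP[].
have /hasP[x] : has (fun x => x \notin [seq frac c | c <- l]) pts.
  rewrite -[has _ _]negbK -all_predC; apply/negP => /allP pts_sub.
  have : (size pts <= size [seq frac c | c <- l])%N.
    by apply: uniq_leq_size => // x /pts_sub /=; rewrite negbK.
  by rewrite size_mkseq size_map ltnn.
move=> /mapP[j _ ->] x_frac; exists j.+2%:R^-1 => c cl.
apply: contra x_frac => /intrP[k xck]; apply/mapP; exists c => //.
have cE : - c = j.+2%:R^-1 - k%:~R by rewrite -xck; ring.
rewrite /frac (@floor_def _ _ (- k)) cE rmorphN /=; first by ring.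
rewrite lerDr invr_ge0 ler0n /= rmorphD rmorphN /= addrC ltrD2l.
by rewrite invf_lt1 ?ltr1n ?ltr0n.
Qed.

End AvoidInt.

(** * The Jacobi side *)

Section Jacobi.
Variable R : realType.
Implicit Types (a b m x y : R) (p : {poly R}).

Lemma powR_predM a x : 0 < x -> x `^ a = x `^ (a - 1) * x.
Proof.
move=> x0; have xN0 : x != 0 by rewrite gt_eqF.
by rewrite powRB ?xN0 ?implybT// powRr1 ?ltW// divfK.
Qed.

Lemma near_unit_interval x : 0 < x < 1 -> \forall y \near x, 0 < y < 1.
Proof.
move=> x01; have : x \in `]0, 1[%R by rewrite in_itv.
by move/near_in_itvoo; apply: filterS => y; rewrite in_itv.
Qed.

Lemma is_derive_jacobi_weight a b m p x : 0 < x < 1 ->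
  is_derive x 1 (fun y => y `^ a * ((1 - y) `^ (b + m) * p.[y]))
    (x `^ (a - 1) * ((1 - x) `^ (b + (m - 1)) * (ladder_step 0 b a m p).[x])).
Proof.
move=> /andP[x0 x1]; have y0 : 0 < 1 - x by rewrite subr_gt0.
have d1 : is_derive x 1 (fun y : R => 1 - y) (-1).
  have d := is_deriveB (is_derive_cst (1 : R) x 1) (is_derive_id x 1).
  by apply: (is_derive_eq d); rewrite sub0r.
have dw := is_derive1_powR a x0.
have dv : is_derive x 1 (fun y => (1 - y) `^ (b + m))
    ((b + m) * (1 - x) `^ (b + m - 1) * -1).
  have dz := is_derive1_powR (b + m) y0.
  exact: (@is_derive1_comp R ((@powR R)^~ (b + m)) (fun y => 1 - y)
    _ _ _ dz d1).
have dp := is_derive_poly p x.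
have dM := is_deriveM dw (is_deriveM dv dp).
apply: (is_derive_eq dM) => /=.
rewrite -![_ *: _]/(_ * _) fctE [b + (m - 1)]addrA.
rewrite [x `^ a]powR_predM// [(1 - x) `^ (b + m)]powR_predM//.
have -> : (ladder_step 0 b a m p).[x]
    = (a * (1 - x) - (m + b) * x) * p.[x] + x * (1 - x) * p^`().[x].
  by rewrite ladder_step0 !hornerE.
ring.
Qed.

(** Equality on the open interval suffices to differentiate, and it is all that
is known about f when f is itself the result of inner operators. *)
Lemma derive1n_jacobi_weight a b m p k (f : R -> R) x :
  (forall y, 0 < y < 1 -> f y = y `^ a * ((1 - y) `^ (b + m) * p.[y])) ->
  0 < x < 1 ->
  derive1n k f x = x `^ (a - k%:R)
    * ((1 - x) `^ (b + (m - k%:R)) * (ladder 0 b k a m p).[x]).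
Proof.
move=> fE; elim: k x => [|k IH] x x01 /=; first by rewrite !subr0 fE.
rewrite -natr1 derive1E.
have d := is_derive_jacobi_weight (a - k%:R) b (m - k%:R)
  (ladder 0 b k a m p) x01.
rewrite (near_eq_derive _ (g := fun y => y `^ (a - k%:R)
    * ((1 - y) `^ (b + (m - k%:R)) * (ladder 0 b k a m p).[y]))).
  by rewrite derive_val opprD !addrA.
by apply: filterS (near_unit_interval x01) => y /IH.
Qed.

Lemma jacobi_ops_weight b (l : seq (R * nat)) (c : nat) x : 0 < x < 1 ->
  foldr (fun u => jacobi_op u.1 u.2)
    (fun y => (1 - y) `^ (b + (c + sumn (unzip2 l))%:R)) l x
  = (1 - x) `^ (b + c%:R) * (rodrigues_poly 0 b l c%:R).[x].
Proof.
elim: l c x => [|[al n] l IH] c x x01 /=; first by rewrite addn0 hornerC mulr1.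
rewrite addnA -natrD {1}/jacobi_op.
rewrite (@derive1n_jacobi_weight (al + n%:R) b (c + n)%:R
  (rodrigues_poly 0 b l (c + n)%:R))//; last first.
  by move=> y y01; rewrite IH.
have -> : (c + n)%:R - n%:R = c%:R :> R by rewrite natrD addrK.
rewrite addrK mulrA -powRD ?addNr ?powRr0 ?mul1r//.
by case/andP: x01 => x0 _; rewrite (gt_eqF x0) implybT.
Qed.

Lemma jacobi_rodriguesE (r : nat) (n : 'I_r -> nat) (alpha0 : R)
    (alpha : 'I_r -> R) x : 0 < x < 1 ->
  jacobi_rodrigues n alpha0 alpha x
  = rodrigues_const n alpha0 alpha
    * (rodrigues_poly 0 alpha0 (multi_seq n alpha) 0).[x].
Proof.
move=> x01; have y0 : 0 < 1 - x by case/andP: x01; rewrite subr_gt0.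
rewrite /jacobi_rodrigues big_comp_multi.
have := @jacobi_ops_weight alpha0 (multi_seq n alpha) 0 x x01.
rewrite add0n sumn_multi_seq addr0 => ->.
rewrite powRN /rodrigues_const; move: (\prod_(i < r) _)^-1 => D'; field.
by rewrite powR_eq0 gt_eqF.
Qed.

End Jacobi.

(** * The limit *)

Section Limit.
Variables (R : realType) (r : nat) (n : 'I_r -> nat) (alpha0 : R).
Variable (alpha : 'I_r -> R).

Let Q (e : R[i]) : {poly R[i]} := rodrigues_poly e alpha0%:C
  [seq (u.1%:C, u.2) | u <- multi_seq n alpha] 0.

(** The points u k = s0 + k satisfy all the genericity conditions at once, since
these are invariant under integer translations. *)
Lemma hahn_eq_rodrigues_poly (N : nat) (H : {poly R[i]}) : (0 < N)%N ->
  is_hahn n alpha0 alpha N H -> forall x : R[i],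
  N%:R ^- multi_size n * H.[N%:R * x]
  = (rodrigues_const n alpha0 alpha)%:C * (Q N%:R^-1).[x].
Proof.
move=> N0 [_ HE] x; have NC0 : N%:R != 0 :> R[i] by rewrite pnatr_eq0 -lt0n.
have [s0 s0Z] := exists_avoid_int
  [:: 0, - alpha0 & [seq alpha i | i <- index_enum 'I_r]].
pose u k : R[i] := s0%:C + k%:R.
have uA k : admissible alpha0%:C (multi_seq n alpha) (u k).
  have shift c : s0 + c \isn't a Num.int -> nonint ((s0 + c)%:C + k%:R).
    by move=> cZ; apply: nonintDn; exists (s0 + c).
  split.
  - by have := shift 0 (s0Z 0 (mem_head _ _)); rewrite addr0.
  - have := shift (- alpha0) (s0Z _ _); rewrite !inE eqxx orbT => /(_ isT).
    by rewrite rmorphD rmorphN addrAC.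
  - move=> _ /mapP[i _ ->] /=; have := shift (alpha i) (s0Z _ _).
    rewrite !inE map_f ?mem_index_enum ?orbT// => /(_ isT).
    by rewrite rmorphD /= [s0%:C + _]addrC addrA.
have nonint_neq z (k : int) : nonint z -> z != k%:~R.
  move=> /(nonintDz (- k)); rewrite rmorphN /= => /nonint_neq0.
  by rewrite subr_eq0.
have -> : H = ((rodrigues_const n alpha0 alpha)%:C * N%:R ^+ multi_size n)
              *: (Q N%:R^-1 \Po (N%:R^-1 *: 'X)).
  apply: (@poly_eq_seq _ _ _ u) => [i j /addrI/eqP|k].
    by rewrite eqr_nat => /eqP.
  have [uZ ubZ ulZ] := uA k.
  rewrite HE; first last.
  - move=> i k'; apply: nonint_neq; rewrite addrC.
    by apply: (ulZ (alpha i, n i)); apply: map_f; rewrite mem_index_enum.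
  - by move=> k'; exact: nonint_neq.
  - by move=> k'; exact: nonint_neq.
  rewrite hahn_rodriguesE// hornerZ horner_comp hornerZ hornerX.
  by rewrite [_^-1 * _]mulrC.
rewrite hornerZ horner_comp hornerZ hornerX mulKf// mulrA.
by rewrite mulrCA mulVf ?mulr1// expf_neq0.
Qed.

Lemma jacobi_eq_rodrigues_poly (P : {poly R[i]}) :
  is_jacobi n alpha0 alpha P ->
  P = (rodrigues_const n alpha0 alpha)%:C *: Q 0.
Proof.
move=> [_ PE]; apply: (@poly_eq_seq _ _ _ (fun k => (k.+2%:R^-1)%:C)).
  by move=> i j /complexI/invr_inj/eqP; rewrite eqr_nat => /eqP[].
move=> k; have k01 : 0 < (k.+2%:R^-1 : R) < 1.
  by rewrite invr_gt0 ltr0n invf_lt1 ?ltr1n ?ltr0n.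
rewrite PE// jacobi_rodriguesE// hornerZ rmorphM /=; congr (_ * _).
by rewrite -horner_map /= map_rodrigues_poly rmorph0.
Qed.

End Limit.

Lemma cvg_invn_complex (R : realType) :
  (fun N : nat => N%:R^-1 : R[i]^o) @ \oo --> (0 : R[i]^o).
Proof.
have : (fun N : nat => N%:R^-1 : R) @ \oo --> (0 : R).
  by rewrite -cvg_shiftS; exact: cvg_harmonic.
move/cvg_real_complex; under eq_fun do rewrite fmorphV rmorph_nat.
by [].
Qed.

Lemma continuous_horner_complex (R : realType) (q : {poly R[i]}) :
  continuous (horner q : R[i]^o -> R[i]^o).
Proof.
move=> x; elim/poly_ind: q => [|q c IH].
  have -> : horner 0 = (cst 0 : R[i]^o -> R[i]^o).
    by apply/funext => y; rewrite horner0.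
  exact: cst_continuous.
have -> : horner (q * 'X + c%:P) = (fun y : R[i]^o => q.[y] * y + c : R[i]^o).
  by apply/funext => y; rewrite hornerMXaddC.
apply: (@continuousD R[i] R[i]^o R[i]^o (fun y => q.[y] * y) (cst c)).
  apply: (@continuousM R[i] R[i]^o (horner q) id) => //.
exact: cst_continuous.
Qed.

Theorem proposition2 (R : realType) (r : nat) (n : 'I_r -> nat)
    (alpha0 : R) (alpha : 'I_r -> R)
    (H : nat -> {poly R[i]}) (P : {poly R[i]}) :
  (1 <= r)%N ->
  (1 <= multi_size n)%N ->
  -1 < alpha0 ->
  (forall i, -1 < alpha i) ->
  (forall i j, i != j -> alpha i - alpha j \isn't a Num.int) ->
  (forall N : nat, (multi_size n <= N)%N -> is_hahn n alpha0 alpha N (H N)) ->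
  is_jacobi n alpha0 alpha P ->
  forall x : R[i],
    (fun N : nat => N%:R ^- multi_size n * (H N).[N%:R * x] : R[i]^o) @ \oo
      --> (P.[x] : R[i]^o).
Proof.
move=> _ M0 _ _ _ HH /jacobi_eq_rodrigues_poly -> x.
have [q qE] := rodrigues_poly_family alpha0%:C
  [seq (u.1%:C, u.2) | u <- multi_seq n alpha] 0 x.
rewrite hornerZ qE -hornerZ.
have := continuous_cvg _ (@continuous_horner_complex R
  ((rodrigues_const n alpha0 alpha)%:C *: q) 0) (@cvg_invn_complex R).
move/(_ _); apply: cvg_trans; apply: near_eq_cvg; near=> N.
have MN : (multi_size n <= N)%N by near: N; exact: nbhs_infty_ge.
rewrite (hahn_eq_rodrigues_poly (leq_trans M0 MN) (HH N MN)) qE.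
by rewrite /= hornerZ.
Unshelve. all: by end_near. Qed.
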